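(* Let $\mathbb{K}\in\{\mathbb{R},\mathbb{C},\mathbb{H}\}$, let $m\geq 2$ be an integer and let $p\in 2\mathbb{N}=\{2,4,6,\ldots\}$. Let $N_{\mathbb{K}}(m,p)$ be the minimal $n$ such that there exists a $\mathbb{K}$-linear isometric embedding $\ell_{2;\mathbb{K}}^m\rightarrow\ell_{p;\mathbb{K}}^n$, and let $\Phi_{\mathbb{K}}(m,p)$ be the real vector space of homogeneous polynomials (forms) $\phi$ over $\mathbb{R}$ of degree $p$ in the real coordinates on $\mathbb{K}^m$ such that $\phi(x\alpha)=\phi(x)$ for all $x\in\mathbb{K}^m$ and all $\alpha\in\mathbb{K}$ with $|\alpha|=1$. Then $$N_{\mathbb{K}}(m,p)\leq \dim_{\mathbb{R}}\Phi_{\mathbb{K}}(m,p)-1.$$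
   Context: $\mathbb{K}$ is one of the real numbers $\mathbb{R}$, the complex numbers $\mathbb{C}$, or the quaternions $\mathbb{H}$. $\mathbb{K}^n$ is the $\mathbb{K}$-linear space of columns $x=[\xi_i]_1^n$, $\xi_i\in\mathbb{K}$, with right multiplication by scalars $\alpha\in\mathbb{K}$; ''linear'' means linear with respect to this right multiplication. For $1\leq p<\infty$, the normed space $\ell_{p;\mathbb{K}}^n$ is $\mathbb{K}^n$ with the norm $\|x\|_p=\left(\sum_{i=1}^n|\xi_i|^p\right)^{1/p}$. An isometric embedding $\ell_{2;\mathbb{K}}^m\to\ell_{p;\mathbb{K}}^n$ is a $\mathbb{K}$-linear map $f$ with $\|fx\|_p=\|x\|_2$ for all $x$. It is known that for every $m\geq 2$ and $p\in 2\mathbb{N}$ such an embedding exists for some $n$, so $N_{\mathbb{K}}(m,p)$ is well defined. Forms are real-valued, and the zero form is included in $\Phi_{\mathbb{K}}(m,p)$; for $\mathbb{K}=\mathbb{R}$ the invariance condition holds automatically since $p$ is even, so $\Phi_{\mathbb{R}}(m,p)$ consists of all forms of degree $p$ on $\mathbb{R}^m$. *)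

(* Defs.v *)
From HB Require Import structures.
From mathcomp Require Import all_boot all_order all_algebra.
From mathcomp Require Import boolp reals exp.
From mathcomp Require Import complex ring.
From mathcomp Require mpoly.
Import -(notations) mpoly.

Set Implicit Arguments.
Unset Strict Implicit.
Unset Printing Implicit Defensive.

Import Order.TTheory GRing.Theory Num.Theory.
Local Open Scope ring_scope.

(* Quat a b c d stands for a + b i + c j + d k. *)
Record quaternion (R : Type) : Type :=
  Quat { qre : R; qi : R; qj : R; qk : R }.

Section QuaternionRing.
Variable R : realType.
Local Notation H := (quaternion R).

Definition quat_to_tuple (x : H) : R * R * R * R :=
  (qre x, qi x, qj x, qk x).
Definition tuple_to_quat (t : R * R * R * R) : H :=
  let: (a, b, c, d) := t in Quat a b c d.
Lemma quat_to_tupleK : cancel quat_to_tuple tuple_to_quat.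
Proof. by case. Qed.

HB.instance Definition _ := Choice.copy H (can_type quat_to_tupleK).

Definition quat_zero : H := Quat 0 0 0 0.
Definition quat_one : H := Quat 1 0 0 0.
Definition quat_opp (x : H) : H :=
  Quat (- qre x) (- qi x) (- qj x) (- qk x).
Definition quat_add (x y : H) : H :=
  Quat (qre x + qre y) (qi x + qi y) (qj x + qj y) (qk x + qk y).
Definition quat_mul (x y : H) : H :=
  Quat (qre x * qre y - qi x * qi y - qj x * qj y - qk x * qk y)
       (qre x * qi y + qi x * qre y + qj x * qk y - qk x * qj y)
       (qre x * qj y - qi x * qk y + qj x * qre y + qk x * qi y)
       (qre x * qk y + qi x * qj y - qj x * qi y + qk x * qre y).

Lemma quat_addA : associative quat_add.
Proof. by move=> x y z; congr Quat; rewrite /= addrA. Qed.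
Lemma quat_addC : commutative quat_add.
Proof. by move=> x y; congr Quat; rewrite /= addrC. Qed.
Lemma quat_add0 : left_id quat_zero quat_add.
Proof. by case=> a b c d; congr Quat; rewrite /= add0r. Qed.
Lemma quat_addN : left_inverse quat_zero quat_opp quat_add.
Proof. by move=> x; congr Quat; rewrite /= addNr. Qed.

HB.instance Definition _ :=
  GRing.isZmodule.Build H quat_addA quat_addC quat_add0 quat_addN.

Lemma quat_mulA : associative quat_mul.
Proof. by move=> x y z; congr Quat => /=; ring. Qed.
Lemma quat_mul1l : left_id quat_one quat_mul.
Proof. by case=> a b c d; congr Quat => /=; ring. Qed.
Lemma quat_mul1r : right_id quat_one quat_mul.
Proof. by case=> a b c d; congr Quat => /=; ring. Qed.
Lemma quat_mulDl : left_distributive quat_mul quat_add.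
Proof. by move=> x y z; congr Quat => /=; ring. Qed.
Lemma quat_mulDr : right_distributive quat_mul quat_add.
Proof. by move=> x y z; congr Quat => /=; ring. Qed.
Lemma quat_oner_neq0 : quat_one != 0.
Proof. by apply/eqP => -[] /eqP; rewrite oner_eq0. Qed.

HB.instance Definition _ := GRing.Zmodule_isNzRing.Build H
  quat_mulA quat_mul1l quat_mul1r quat_mulDl quat_mulDr quat_oner_neq0.

End QuaternionRing.

Variant scalar_kind : Type := Reals | Complexes | Quaternions.

Definition scalar_ring (R : realType) (k : scalar_kind) : nzRingType :=
  match k with
  | Reals => R
  | Complexes => R[i]
  | Quaternions => quaternion R
  end.

Definition real_dim (k : scalar_kind) : nat :=
  match k with Reals => 1 | Complexes => 2 | Quaternions => 4 end.

Definition scalar_coords (R : realType) (k : scalar_kind) :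
    scalar_ring R k -> seq R :=
  match k return scalar_ring R k -> seq R with
  | Reals => fun x => [:: x]
  | Complexes => fun z => [:: complex.Re z; complex.Im z]
  | Quaternions => fun q => [:: qre q; qi q; qj q; qk q]
  end.

Definition scalar_abs (R : realType) (k : scalar_kind) : scalar_ring R k -> R :=
  match k return scalar_ring R k -> R with
  | Reals => fun x => `|x|
  | Complexes => fun z => ComplexField.Normc.normc z
  | Quaternions => fun q =>
      Num.sqrt (qre q ^+ 2 + qi q ^+ 2 + qj q ^+ 2 + qk q ^+ 2)
  end.

Section Spaces.
Variables (R : realType) (k : scalar_kind).
Local Notation K := (scalar_ring R k).

Definition rscale (m : nat) (x : 'cV[K]_m) (a : K) : 'cV[K]_m :=
  \col_i (x i 0 * a).

Definition right_linear (m n : nat) (f : 'cV[K]_m -> 'cV[K]_n) : Prop :=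
  (forall x y, f (x + y) = f x + f y) /\
  (forall x a, f (rscale x a) = rscale (f x) a).

Definition lp_norm (p : R) (n : nat) (x : 'cV[K]_n) : R :=
  (\sum_(i < n) scalar_abs (x i 0) `^ p) `^ p^-1.

Definition isometric_embedding (p : R) (m n : nat)
    (f : 'cV[K]_m -> 'cV[K]_n) : Prop :=
  right_linear f /\ forall x, lp_norm p (f x) = lp_norm 2 x.

Definition embeddable (p : R) (m n : nat) : Prop :=
  exists f : 'cV[K]_m -> 'cV[K]_n, isometric_embedding p f.

Definition is_min_embedding_dim (p : R) (m N : nat) : Prop :=
  embeddable p m N /\ forall n, embeddable p m n -> (N <= n)%N.

Definition real_coords (m : nat) (x : 'cV[K]_m) : seq R :=
  flatten [seq scalar_coords (x i 0) | i <- enum 'I_m].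

(* For m > 0 this is m * real_dim k; the successor form is what the
   finite-dimensionality of mpoly.dhomog asks for. *)
Definition nvars (m : nat) : nat := (m * real_dim k).-1.+1.

Definition real_form (m p : nat) : vectType R := mpoly.dhomog (nvars m) R p.

Definition form_eval (m p : nat) (phi : real_form m p) (x : 'cV[K]_m) : R :=
  mpoly.meval (fun i : 'I_(nvars m) => (real_coords x)`_i)
    (mpoly.mpoly_of_dhomog phi).

Definition unit_invariant (m p : nat) (phi : real_form m p) : Prop :=
  forall (x : 'cV[K]_m) (a : K), scalar_abs a = 1 ->
    form_eval phi (rscale x a) = form_eval phi x.

End Spaces.

Lemma ex_vspace (F : fieldType) (V : vectType F) (S : V -> Prop) :
  S 0 -> (forall a u v, S u -> S v -> S (a *: u + v)) ->
  exists U : {vspace V}, forall v, v \in U <-> S v.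
Proof.
move=> S0 Slin.
pose sub (U : {vspace V}) := forall v, v \in U -> S v.
pose P n := `[< exists U, sub U /\ \dim U = n >].
have exP : exists n, P n.
  exists 0; apply/asboolP; exists 0%VS; split; last exact: dimv0.
  by move=> v; rewrite memv0 => /eqP ->.
have ubP n : P n -> (n <= \dim {:V})%N.
  by move=> /asboolP[U [_ <-]]; exact: dimvS (subvf U).
case: (ex_maxnP exP ubP) => n /asboolP[U [subU dimU]] maxn.
exists U => v; split; first exact: subU.
move=> Sv; apply: contrapT => /negP vNU.
have : P (\dim (<[v]> + U)%VS).
  apply/asboolP; exists (<[v]> + U)%VS; split=> // w.
  case/memv_addP => _ /vlineP[a ->] [u uU ->].
  by apply: Slin => //; exact: subU.
move/maxn; rewrite leqNgt -dimU => /negP; apply.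
rewrite (ltn_leqif (dimv_leqif_sup (addvSr <[v]>%VS U))).
apply: contra vNU => /subvP; apply.
by apply: (subvP (addvSl _ _)); exact: memv_line.
Qed.

Lemma unit_invariant_vspace (R : realType) (k : scalar_kind) (m p : nat) :
  exists U : {vspace real_form R k m p},
    forall phi, phi \in U <-> unit_invariant phi.
Proof.
have evalP c (f g : real_form R k m p) x :
    form_eval (c *: f + g) x = c * form_eval f x + form_eval g x.
  by rewrite /form_eval !linearP.
apply: ex_vspace => [x a _|c f g If Ig x a a1].
  by rewrite /form_eval !raddf0.
by rewrite !evalP If // Ig.
Qed.

Definition Phi (R : realType) (k : scalar_kind) (m p : nat) :
    {vspace real_form R k m p} :=
  projT1 (cid (unit_invariant_vspace R k m p)).

Lemma memPhi (R : realType) (k : scalar_kind) (m p : nat)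
    (phi : real_form R k m p) : phi \in Phi R k m p <-> unit_invariant phi.
Proof. exact: (projT2 (cid (unit_invariant_vspace R k m p))). Qed.

(* Main.v *)
Require Import Defs.
From mathcomp Require Import all_boot all_order all_algebra.
From mathcomp Require Import reals boolp classical_sets exp complex.
From mathcomp Require Import topology normedtype derive.
From mathcomp Require mpoly.
Import -(notations) mpoly.
From mathcomp Require Import ring lra.
Set Implicit Arguments.
Unset Strict Implicit.
Unset Printing Implicit Defensive.
Import Order.TTheory GRing.Theory Num.Theory.
Import numFieldNormedType.Exports.
Local Open Scope ring_scope.

(** For u in K^m let <u,x> = sum_j u_j x_j and phi_u(x) = |<u,x>|^p.  The
    coordinates of a right-linear map are functionals <u_i,.>, so an isometric
    embedding into the n-dimensional space amounts to an identity
    |x|^p = phi_{u_1}(x) + ... + phi_{u_n}(x).  The forms phi_u belong to Phi,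
    and nonnegative multiples of such forms are again such forms; the question
    is how many of them are needed to write |x|^p as their sum.

    Some identity exists.  For K = R ([hilbert_identity]), let F be a sum of
    powers <v,x>^p, with sum_v |v|^p = 1, whose squared norm
    sum_{u,v} <u,v>^p is least.  A minimum exists by compactness, since
    Carathéodory's theorem bounds the number of vectors needed.  This norm is
    invariant under reflections and strictly convex, so the minimum F is
    invariant under reflections, and therefore a multiple of |x|^p.  In general
    ([hilbert_identity_scalars]), view K^m as a real space, so that |x|^p is a
    sum of powers of the real functions Re <u,x>.  Substituting x a for x and
    summing over suitable scalars a turns Re into the absolute value.

    The identity can be shortened ([short_identity]).  By Carathéodory's
    theorem for cones ([cone_caratheodory]) the terms can be made linearly
    independent, so there are at most D = dim Phi of them.  Suppose that there
    are exactly D.  They form a basis of Phi, with |x|^p having all coordinates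
    1.  Moving u along the segment from u_1 to u_2, the maximal coordinate of
    phi_u has to pass from index 1 to another index, so that at some moment it
    is attained at two indices.  Subtracting from |x|^p the largest multiple of
    that phi_u which leaves all coordinates nonnegative kills two coordinates
    at the price of one new term ([cone_fenchel_bunt]).  Hence D - 1 terms
    suffice. *)

(** * Carathéodory's theorem for cones *)

Section Cone.
Variables (R : realType) (V : vectType R) (S : V -> Prop).
Hypothesis scaleS : forall a v, 0 <= a -> S v -> S (a *: v).

Lemma exchange_sum (n : nat) (e : 'I_n -> V) (c : 'I_n -> R) (M : R) :
  M != 0 ->
  \sum_i e i = M^-1 *: (\sum_i c i *: e i) + \sum_i (1 - c i / M) *: e i.
Proof.
move=> M0; rewrite scaler_sumr -big_split /=; apply: eq_bigr => i _.
by rewrite scalerA -scalerDl mulrC addrC subrK scale1r.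
Qed.

(** The multiple M^-1 of the combination with coefficients c, where M is the
    largest coefficient, leaves the weights 1 - c i / M >= 0 to the e i, and
    these vanish wherever the maximum is attained.  So one new vector makes
    all the terms with maximal coefficient superfluous. *)
Lemma exchange_cone (n : nat) (e : 'I_n -> V) (c : 'I_n -> R) (i0 : 'I_n)
    (J : {set 'I_n}) :
  (forall i, S (e i)) -> 0 < c i0 -> (forall i, c i <= c i0) ->
  (forall j, j \in J -> c j = c i0) ->
  exists s : seq V, [/\ (size s <= n - #|J|)%N, (forall v, v \in s -> S v) &
    \sum_i e i = (c i0)^-1 *: (\sum_i c i *: e i) + \sum_(v <- s) v].
Proof.
move=> Se c0 cmax cJ.
exists [seq (1 - c i / c i0) *: e i | i <- enum (~: J)]; split.
- by rewrite size_map -cardE -[n in (n - _)%N](card_ord n) -(cardsC J) addKn.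
- move=> v /mapP[i _ ->]; apply: scaleS => //.
  by rewrite subr_ge0 ler_pdivrMr // mul1r.
- rewrite (exchange_sum e c (lt0r_neq0 c0)); congr (_ + _).
  rewrite big_map big_enum_cond /= [RHS]big_mkcond /=; apply: eq_bigr => i _.
  rewrite andbT inE; case: ifPn => //; rewrite negbK => iJ.
  by rewrite cJ // divff ?lt0r_neq0 // subrr scale0r.
Qed.

(** Carathéodory's theorem for cones: a linear relation, normalized to have a
    positive coefficient, is a zero vector to exchange, which removes a term
    and puts nothing in its place. *)
Lemma cone_caratheodory (s : seq V) : (forall v, v \in s -> S v) ->
  exists s', [/\ free s', (forall v, v \in s' -> S v) &
    \sum_(v <- s') v = \sum_(v <- s) v].
Proof.
move: {2}(size s) (leqnn (size s)) => n; elim: n s => [|n IH] s sn Ss.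
  by exists s; split => //; move: sn; rewrite leqn0 => /nilP ->; exact: nil_free.
have [fs|nfs] := boolP (free s); first by exists s.
have [k [k0 [i ki]]] : exists k : 'I_(size s) -> R,
    \sum_i k i *: s`_i = 0 /\ exists i, k i != 0.
  apply: contrapT => H; move/negP: nfs; apply.
  rewrite -[s]/(val (in_tuple s)); apply/freeP => k k0 i; apply/eqP.
  apply: contrapT => /negP ki.
  by apply: H; exists k; split => //; exists i.
wlog ki0 : k k0 ki / 0 < k i.
  move=> H; have [kip|kin|/eqP] := ltrgt0P (k i); last by rewrite (negPf ki).
    exact: (H k).
  apply: (H (fun i => - k i)); rewrite ?oppr_eq0 ?oppr_gt0 //.
  by under eq_bigr do rewrite scaleNr; rewrite sumrN k0 oppr0.
pose i0 := [arg max_(j > i) k j]%O.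
have kmax j : k j <= k i0 by rewrite /i0; case: arg_maxP => // l _; apply.
have ki00 : 0 < k i0 := lt_le_trans ki0 (kmax i).
have [s1 [ss1 Ss1 e1]] := @exchange_cone _ (fun i => s`_i) k i0 [set i0]
  (fun i => Ss _ (mem_nth 0 (ltn_ord i))) ki00 kmax
  (fun j jJ => congr1 k (finset.set1P jJ)).
have [|s' [fs' Ss' es']] := IH s1 _ Ss1.
  by rewrite -ltnS (leq_trans _ sn) // (leq_ltn_trans ss1) // cards1 subn1
             prednK // (leq_trans _ (ltn_ord i)).
exists s'; split => //; rewrite es'.
by rewrite [RHS](big_nth 0) big_mkord e1 k0 scaler0 add0r.
Qed.

End Cone.

(** The minimum of the family changes sign between 0 and 1. *)
Lemma IVT_min (R : realType) (I : finType) (f : I -> R -> R) :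
  (forall i, continuous (f i)) -> (forall i, 0 < f i 0) ->
  (exists i, f i 1 < 0) ->
  exists t, (forall i, 0 <= f i t) /\ exists i, f i t = 0.
Proof.
move=> fc f0 [i1 f1].
pose g t : R := \big[Num.min/f i1 t]_i f i t.
have gc : continuous g.
  rewrite /g => t; elim: (index_enum I) => [|i l IH].
    by under eq_fun do rewrite big_nil; exact: fc.
  under eq_fun do rewrite big_cons.
  by apply: (@continuous_min R R (f i)) => //; exact: fc.
have gle i t : g t <= f i t by exact: bigmin_le_cond.
have gE t : exists i, g t = f i t.
  rewrite /g; elim: (index_enum I) => [|i l [j IH]].
    by exists i1; rewrite big_nil.
  by rewrite big_cons IH; case: (leP (f i t) (f j t)); [exists i | exists j].
have [i0 e0] := gE 0.
have [t _ gt0] : exists2 t, t \in `[0, 1] & g t = 0.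
  apply: IVT => //; first by apply: continuous_subspaceT.
  apply/andP; split.
    by rewrite ge_min (ltW (le_lt_trans (gle i1 1) f1)) orbT.
  by rewrite le_max e0 (ltW (f0 i0)).
exists t; split=> [i|]; first by rewrite -gt0 gle.
by have [i ei] := gE t; exists i; rewrite -ei.
Qed.

(** * Connected cones: one generator fewer *)

Section FenchelBunt.
Variables (R : realType) (V : vectType R) (U : {vspace V}) (S : V -> Prop).
Hypothesis scaleS : forall a v, 0 <= a -> S v -> S (a *: v).
Hypothesis SU : forall v, S v -> v \in U.
Hypothesis pointedS : forall s : seq V, (forall v, v \in s -> S v) ->
  \sum_(v <- s) v = 0 -> forall v, v \in s -> v = 0.
Hypothesis pathS : forall e1 e2 : V, S e1 -> S e2 -> free [:: e1; e2] ->
  exists h : R -> V, [/\ h 0 = e1, h 1 = e2, forall t, S (h t) /\ h t != 0 &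
    forall n (X : n.-tuple V) i, continuous (fun t => coord X i (h t))].

(** The conic form of the theorem of Fenchel and Bunt.  If the terms e i form a
    basis, expand h t along a path of generators from e 0 to e 1.  The largest
    coordinate is the one of index 0 at the start and the one of index 1 at the
    end, so that by continuity it is attained twice at some moment.  Exchanging
    h t there brings in one vector and removes two. *)
Lemma cone_fenchel_bunt (s : seq V) : (forall v, v \in s -> S v) ->
  free s -> size s = \dim U -> (2 <= size s)%N ->
  exists s', [/\ (size s' < size s)%N, (forall v, v \in s' -> S v) &
    \sum_(v <- s') v = \sum_(v <- s) v].
Proof.
move=> Ss fs sU s2.
have bs : basis_of U (in_tuple s).
  rewrite basisEfree fs -sU leqnn andbT.
  by apply/span_subvP => v /Ss /SU.
have f2 : free [:: s`_0; s`_1].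
  move: fs s2; case: (s) => [|a [|b l]] //= fabl _.
  by rewrite -[_ :: _]/([:: a; b] ++ l) in fabl; exact: catl_free fabl.
pose i0 : 'I_(size s) := Ordinal (leq_trans (isT : 0 < 2)%N s2).
pose i1 : 'I_(size s) := Ordinal s2.
have Si (i : 'I_(size s)) : S s`_i by apply: Ss; exact: mem_nth.
have [h [h0 h1 hS hc]] : exists h : R -> V,
    [/\ h 0 = s`_0, h 1 = s`_1, forall t, S (h t) /\ h t != 0 &
    forall n (X : n.-tuple V) i, continuous (fun t => coord X i (h t))].
  apply: pathS; [exact: (Si i0)|exact: (Si i1)|done].
pose c t (i : 'I_(size s)) := coord (in_tuple s) i (h t).
have hE t : h t = \sum_i c t i *: s`_i.
  by rewrite (coord_basis bs (SU (proj1 (hS t)))).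
(* If all coordinates were nonpositive, then h t and the nonnegative multiples
   - c t i *: e i would be elements of the cone with sum zero. *)
have cpos t : exists i, 0 < c t i.
  apply: contrapT => H.
  have cle i : 0 <= - c t i.
    by rewrite oppr_ge0 leNgt; apply/negP => ci; apply: H; exists i.
  have [_ /eqP[]] := hS t.
  apply: (@pointedS (h t :: [seq (- c t i) *: s`_i | i <- enum 'I_(size s)])).
  - move=> v; rewrite inE => /predU1P[->|/mapP[i _ ->]]; first by have [] := hS t.
    exact: scaleS.
  - rewrite big_cons big_map big_enum /= {1}hE -big_split /= big1 // => i _.
    by rewrite scaleNr addrN.
  - exact: mem_head.
(* The differences c t i0 - c t i for i != i0 are all positive at 0, and the one
   of index i1 is negative at 1; where their minimum vanishes, index i0 and
   another index share the maximum. *)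
pose I := {i : 'I_(size s) | i != i0}.
have [t [tge [[i ii0] /= /eqP]]] : exists t,
    (forall i : I, 0 <= c t i0 - c t (val i)) /\
    exists i : I, c t i0 - c t (val i) = 0.
  apply: IVT_min => [i t|[i ii0] /=|].
  - by apply: cvgB; exact: hc.
  - rewrite /c h0 -[0%N]/(val i0) !coord_free // eqxx.
    by rewrite eq_sym (negPf ii0) subr0 ltr01.
  - have ii : i1 != i0 by rewrite -val_eqE.
    exists (exist _ i1 ii) => /=; rewrite /c h1 -[1%N]/(val i1) !coord_free //.
    by rewrite (negPf ii) eqxx sub0r ltrN10.
rewrite subr_eq0 => /eqP ei.
have cmax j : c t j <= c t i0.
  have [->//|ji] := eqVneq j i0.
  by rewrite -subr_ge0; exact: (tge (exist _ j ji)).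
have c0 : 0 < c t i0 by have [j] := cpos t => /lt_le_trans; apply.
have [|s' [ss' Ss' es']] := @exchange_cone _ _ _ scaleS _ (fun i => s`_i) (c t) i0
  [set i; i0] Si c0 cmax _.
  by move=> j /finset.set2P[] ->.
exists ((c t i0)^-1 *: h t :: s'); split.
- rewrite /= (leq_ltn_trans (_ : _ <= (size s - 2).+1)%N) //.
    by rewrite ltnS (leq_trans ss') // cards2 ii0.
  by rewrite -subSn // subSS subn1 prednK // (leq_trans _ s2).
- move=> v; rewrite inE => /predU1P[->|/Ss' //].
  by apply: scaleS; [rewrite invr_ge0 ltW|have [] := hS t].
- by rewrite big_cons [RHS](big_nth 0) big_mkord es' -hE.
Qed.

End FenchelBunt.

(** * Continuity of sums and products *)

Section Continuity.
Variables (R : realType) (T : topologicalType).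
Implicit Types f g : T -> R.

Lemma continuous_mulr f g :
  continuous f -> continuous g -> continuous (fun x => f x * g x).
Proof. by move=> fc gc x; apply: cvgM; [exact: fc|exact: gc]. Qed.

Lemma continuous_bigsum (I : Type) (r : seq I) (F : I -> T -> R) :
  (forall i, continuous (F i)) -> continuous (fun x => \sum_(i <- r) F i x).
Proof.
move=> Fc; elim: r => [|i r IH] x.
  by under eq_fun do rewrite big_nil; exact: cvg_cst.
by under eq_fun do rewrite big_cons; apply: cvgD; [exact: Fc|exact: IH].
Qed.

Lemma continuous_bigprod (I : Type) (r : seq I) (F : I -> T -> R) :
  (forall i, continuous (F i)) -> continuous (fun x => \prod_(i <- r) F i x).
Proof.
move=> Fc; elim: r => [|i r IH] x.
  by under eq_fun do rewrite big_nil; exact: cvg_cst.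
by under eq_fun do rewrite big_cons; apply: cvgM; [exact: Fc|exact: IH].
Qed.

Lemma continuous_expr n f : continuous f -> continuous (fun x => f x ^+ n).
Proof.
move=> fc; elim: n => [|n IH] x.
  by under eq_fun do rewrite expr0; exact: cvg_cst.
by under eq_fun do rewrite exprS; apply: cvgM; [exact: fc|exact: IH].
Qed.

End Continuity.

Lemma exists_root (R : realType) (n : nat) (a : R) : (0 < n)%N -> 0 <= a ->
  exists2 b, 0 <= b & b ^+ n = a.
Proof.
move=> n0 a0; exists (a `^ (n%:R)^-1); first exact: powR_ge0.
by rewrite -powR_mulrn ?powR_ge0 // -powRrM mulVf ?pnatr_eq0 -?lt0n // powRr1.
Qed.

(** * Sums of even powers of real linear forms *)

Section Hilbert.
Variables (R : realType) (d q : nat).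
Hypothesis q_gt0 : (0 < q)%N.
Local Notation vec := 'rV[R]_d.
Implicit Types (u v x y : vec) (s : seq vec).

Definition dot u v : R := \sum_i u 0 i * v 0 i.

Lemma dotC u v : dot u v = dot v u.
Proof. by apply: eq_bigr => i _; rewrite mulrC. Qed.

Lemma dotDl u v x : dot (u + v) x = dot u x + dot v x.
Proof. by rewrite -big_split; apply: eq_bigr => i _; rewrite mxE mulrDl. Qed.

Lemma dotZl a u x : dot (a *: u) x = a * dot u x.
Proof. by rewrite mulr_sumr; apply: eq_bigr => i _; rewrite mxE mulrA. Qed.

Lemma dotNl u x : dot (- u) x = - dot u x.
Proof. by rewrite -scaleN1r dotZl mulN1r. Qed.

Lemma dotDr u v x : dot x (u + v) = dot x u + dot x v.
Proof. by rewrite !(dotC x) dotDl. Qed.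

Lemma dotZr a u x : dot x (a *: u) = a * dot x u.
Proof. by rewrite !(dotC x) dotZl. Qed.

Lemma dotNr u x : dot x (- u) = - dot x u.
Proof. by rewrite !(dotC x) dotNl. Qed.

Lemma dot_ge0 x : 0 <= dot x x.
Proof. by apply: sumr_ge0 => i _; rewrite -expr2 sqr_ge0. Qed.

Lemma dot_eq0 x : (dot x x == 0) = (x == 0).
Proof.
apply/idP/eqP => [/eqP x0|->]; last first.
  by apply/eqP/big1 => i _; rewrite mxE mul0r.
apply/rowP => i; rewrite mxE; apply/eqP; rewrite -sqrf_eq0 expr2.
have /psumr_eq0P : forall i, true -> 0 <= x 0 i * x 0 i.
  by move=> j _; rewrite -expr2 sqr_ge0.
by move/(_ x0 i isT) => ->.
Qed.

Local Notation space := {ffun option {ffun 'I_q.*2 -> 'I_d} -> R^o}.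

(** The coordinate Some f of tensor v is an entry of the tensor power of v of
    degree 2q, so that pairing these coordinates gives powers of dot.  The
    coordinate None carries the degree 2q norm, which makes the normalization
    of a sum of powers a linear function of the sum of tensors. *)
Definition tensor v : space :=
  [ffun o : option {ffun 'I_q.*2 -> 'I_d} =>
    if o is Some f then \prod_k v 0 (f k) else dot v v ^+ q].

(** The squared norm of a form in the rotation invariant inner product in which
    the forms dot u x ^+ 2q and dot v x ^+ 2q have product dot u v ^+ 2q. *)
Definition energy (w : space) : R := \sum_f w (Some f) ^+ 2.

Lemma tensorZ b v : tensor (b *: v) = b ^+ q.*2 *: tensor v.
Proof.
apply/ffunP => -[f|]; rewrite !ffunE.
  under eq_bigr do rewrite mxE.
  by rewrite big_split /= prodr_const card_ord.
by rewrite dotZl dotZr mulrA -expr2 exprMn -exprM mul2n.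
Qed.

Lemma dot_tensor u v :
  \sum_f tensor u (Some f) * tensor v (Some f) = dot u v ^+ q.*2.
Proof.
rewrite -[in RHS](card_ord q.*2) -prodr_const bigA_distr_bigA /=.
by apply: eq_bigr => f _; rewrite !ffunE -big_split.
Qed.

Definition power_sum s : space := \sum_(v <- s) tensor v.

Lemma power_sumE s x :
  \sum_f power_sum s (Some f) * tensor x (Some f) =
  \sum_(v <- s) dot v x ^+ q.*2.
Proof.
under [RHS]eq_bigr do rewrite -dot_tensor.
rewrite exchange_big /=; apply: eq_bigr => f _.
by rewrite /power_sum sum_ffunE mulr_suml.
Qed.

Lemma power_sum_None s : power_sum s None = \sum_(v <- s) dot v v ^+ q.
Proof. by rewrite sum_ffunE; apply: eq_bigr => v _; rewrite ffunE. Qed.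

Lemma energyE s :
  energy (power_sum s) = \sum_(u <- s) \sum_(v <- s) dot v u ^+ q.*2.
Proof.
under [RHS]eq_bigr do rewrite -power_sumE.
rewrite exchange_big /=; apply: eq_bigr => f _.
by rewrite -mulr_sumr expr2 {2}/power_sum sum_ffunE.
Qed.

Let M := \dim {: space}.

(** By Carathéodory's theorem the number of vectors can be fixed, with zero
    vectors as padding; this makes the search for a minimum of the energy a
    problem on a compact set. *)
Lemma power_sum_bounded s : exists v : 'I_M -> vec,
  \sum_a tensor (v a) = power_sum s.
Proof.
have [b v b0|v|s' [fs' Ss' es']] := @cone_caratheodory R space
    (fun w => exists v, w = tensor v) _ [seq tensor v | v <- s].
- move=> [u ->]; have [|c c0 <-] := @exists_root R q.*2 b _ b0.
    by rewrite double_gt0.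
  by exists (c *: u); rewrite tensorZ.
- by move/mapP => [u _ ->]; exists u.
have s'M : (size s' <= M)%N by rewrite -(eqnP fs') dimvS ?subvf.
have /choice[v vE] : forall a : 'I_M, exists v, s'`_a = tensor v.
  move=> a; have [/(mem_nth 0)/Ss'//|/(nth_default 0)->] := ltnP a (size s').
  by exists 0; rewrite -(scale0r (0 : vec)) tensorZ expr0n double_eq0
    (negPf (lt0n_neq0 q_gt0)) scale0r.
exists v; under eq_bigr do rewrite -vE.
rewrite /power_sum -(big_map tensor xpredT id) -es' [RHS](big_nth 0) big_mkord.
rewrite (big_ord_widen _ (fun i => s'`_i) s'M) [RHS]big_mkcond /=.
by apply: eq_bigr => a _; case: ltnP => // /(nth_default 0).
Qed.

(** The normalized families of M vectors form a closed subset of the cube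
    with side [-1, 1], on which the energy is continuous. *)
Lemma exists_min_energy : (0 < d)%N -> exists s, power_sum s None = 1 /\
  forall s', power_sum s' None = 1 ->
  energy (power_sum s) <= energy (power_sum s').
Proof.
move=> d0; pose X := 'rV[R]_(M * d).
pose vs (x : X) (a : 'I_M) : vec := row a (vec_mx x).
have vs_surj (v : 'I_M -> vec) : exists x : X, forall a, vs x a = v a.
  exists (mxvec (\matrix_(a, i) v a 0 i)) => a.
  by apply/rowP => i; rewrite /vs mxvecK !mxE.
pose seqx (x : X) := [seq vs x a | a <- enum 'I_M].
have fE (x : X) : power_sum (seqx x) = \sum_a tensor (vs x a).
  by rewrite /power_sum big_map big_enum.
have vsc a i : continuous (fun x : X => vs x a 0 i).
  under eq_fun do rewrite /vs !mxE; exact: coord_continuous.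
have fc o : continuous (fun x : X => power_sum (seqx x) o : R).
  under eq_fun do rewrite fE sum_ffunE.
  apply: continuous_bigsum => a; case: o => [f|].
    under eq_fun do rewrite ffunE; exact: continuous_bigprod.
  under eq_fun do rewrite ffunE; apply: continuous_expr.
  by apply: continuous_bigsum => i; apply: continuous_mulr; exact: vsc.
pose A : set X := [set x | power_sum (seqx x) None = 1]%classic.
have A0 : (A !=set0)%classic.
  have [v vE] := power_sum_bounded [:: delta_mx 0 (Ordinal d0)].
  have [x xE] := vs_surj v; exists x; rewrite /A /= fE.
  under eq_bigr do rewrite xE.
  rewrite vE power_sum_None big_seq1 /dot (bigD1 (Ordinal d0)) //= big1.
    by rewrite !mxE !eqxx mulr1 addr0 expr1n.
  by move=> i /negPf i0; rewrite !mxE i0 mulr0.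
have Ac : compact A.
  apply: (@subclosed_compact _ _
    [set v : X | forall j, `[-1, 1]%classic (v ord0 j)]%classic).
  - have /continuous_closedP := fc None.
    by move=> /(_ [set 1]%classic); apply; exact: closed_eq.
  - apply: (@rV_compact R _ (fun=> `[-1, 1]%classic)) => _.
    exact: segment_compact.
  - move=> x /=; rewrite /A /= power_sum_None big_map big_enum /= => x1 j.
    case/mxvec_indexP: j => a i.
    have : dot (vs x a) (vs x a) <= 1.
      rewrite -(expr_le1 q_gt0) ?dot_ge0 // -x1 (bigD1 a) //= lerDl.
      by apply: sumr_ge0 => b _; rewrite exprn_ge0 ?dot_ge0.
    rewrite /dot (bigD1 i) //= => le1.
    have : vs x a 0 i * vs x a 0 i <= 1.
      apply: le_trans le1; rewrite lerDl; apply: sumr_ge0 => b _.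
      by rewrite -expr2 sqr_ge0.
    rewrite /vs !mxE -expr2 => /= le2.
    by rewrite in_itv /= -ler_norml -(expr_le1 (isT : 0 < 2)%N) // real_normK
      ?num_real.
have [|x xA xmin] := @compact_EVT_min _ R
    (fun x : X => energy (power_sum (seqx x))) _ A0 Ac.
  apply: continuous_subspaceT; apply: continuous_bigsum => f.
  by apply: continuous_expr; exact: fc.
exists (seqx x); split; first by move: xA; rewrite inE.
move=> s'; have [v <-] := power_sum_bounded s'.
have [y yE] := vs_surj v; under eq_bigr do rewrite -yE.
by rewrite -fE => y1; apply: xmin; rewrite inE.
Qed.

Definition reflection n v : vec := v - (2 * dot v n / dot n n) *: n.

Lemma dot_reflection n u v : n != 0 ->
  dot (reflection n u) (reflection n v) = dot u v.
Proof.
rewrite -dot_eq0 => n0.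
rewrite /reflection !(dotDl, dotDr, dotNl, dotNr, dotZl, dotZr).
by rewrite (dotC n v); field.
Qed.

Lemma dot_reflectionl n u v : dot (reflection n u) v = dot u (reflection n v).
Proof.
rewrite /reflection !(dotDl, dotDr, dotNl, dotNr, dotZl, dotZr).
by rewrite (dotC n v); ring.
Qed.

Lemma reflection_swap x y : dot x x = dot y y -> x != y ->
  reflection (x - y) x = y.
Proof.
move=> xy; rewrite -subr_eq0 -dot_eq0 => n0; rewrite /reflection.
suff -> : 2 * dot x (x - y) / dot (x - y) (x - y) = 1.
  by rewrite scale1r opprB addrC subrK.
have -> : 2 * dot x (x - y) = dot (x - y) (x - y).
  by rewrite !(dotDl, dotDr, dotNl, dotNr) (dotC y x) -xy; ring.
by rewrite divff.
Qed.

(** Strict convexity: the reflected family has the same energy and the same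
    normalization.  The mean of the two sums is normalized as well, so its
    energy is not below the minimum, and the parallelogram identity leaves
    nothing for the distance between the two sums. *)
Lemma min_energy_invariant s n x : n != 0 -> power_sum s None = 1 ->
  (forall s', power_sum s' None = 1 ->
    energy (power_sum s) <= energy (power_sum s')) ->
  \sum_(v <- s) dot v (reflection n x) ^+ q.*2 = \sum_(v <- s) dot v x ^+ q.*2.
Proof.
move=> n0 s1 smin; pose s2 := [seq reflection n v | v <- s].
(* Scaling a vector by b with b ^+ 2q = 1/2 halves its tensor. *)
have [//||b b0 bE] := @exists_root R q.*2 2^-1; first by rewrite double_gt0.
  by rewrite invr_ge0.
pose mid := [seq b *: v | v <- s ++ s2].
have midE : power_sum mid = 2^-1 *: (power_sum s + power_sum s2).
  rewrite /power_sum big_map -big_cat scaler_sumr.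
  by apply: eq_bigr => v _; rewrite tensorZ bE.
have s21 : power_sum s2 None = 1.
  rewrite -s1 !power_sum_None big_map; apply: eq_bigr => v _.
  by rewrite dot_reflection.
have E2 : energy (power_sum s2) = energy (power_sum s).
  rewrite !energyE big_map; apply: eq_bigr => u _; rewrite big_map.
  by apply: eq_bigr => v _; rewrite dot_reflection.
have := smin mid; rewrite midE !ffunE s1 s21 => /(_ _)/wrap[].
  by rewrite /GRing.scale /=; lra.
move=> Emid.
have D0 : \sum_f (power_sum s (Some f) - power_sum s2 (Some f)) ^+ 2 = 0.
  apply: le_anti; rewrite sumr_ge0 ?andbT => [|f _]; last exact: sqr_ge0.
  have -> : \sum_f (power_sum s (Some f) - power_sum s2 (Some f)) ^+ 2 =
      2 * energy (power_sum s) + 2 * energy (power_sum s2) -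
      4 * energy (2^-1 *: (power_sum s + power_sum s2)).
    rewrite /energy !mulr_sumr -big_split -sumrB /=; apply: eq_bigr => f _.
    by rewrite !ffunE /GRing.scale /=; field.
  by rewrite E2; lra.
have FG f : power_sum s (Some f) = power_sum s2 (Some f).
  have /psumr_eq0P := D0; move=> /(_ (fun f _ => sqr_ge0 _) f isT)/eqP.
  by rewrite sqrf_eq0 subr_eq0 => /eqP.
transitivity (\sum_(v <- s2) dot v x ^+ q.*2).
  by rewrite big_map; apply: eq_bigr => v _; rewrite dot_reflectionl.
by rewrite -!power_sumE; apply: eq_bigr => f _; rewrite FG.
Qed.

(** Hilbert's identity.  A sum of powers F of least energy is invariant under
    all reflections.  These act transitively on every sphere around 0, so F is
    a multiple of dot x x ^+ q, and the normalization keeps it from vanishing. *)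
Lemma hilbert_identity : exists s, forall x,
  \sum_(v <- s) dot v x ^+ q.*2 = dot x x ^+ q.
Proof.
have [d0|d0] := posnP d.
  exists [::] => x; rewrite big_nil /dot big1.
    by rewrite expr0n (negPf (lt0n_neq0 q_gt0)).
  move=> i _; move/negP: (lt0n_neq0 (leq_ltn_trans (leq0n i) (ltn_ord i))).
  by case; apply/eqP.
have [s [s1 smin]] := exists_min_energy d0.
pose F x := \sum_(v <- s) dot v x ^+ q.*2.
have FZ b x : F (b *: x) = (b ^+ 2) ^+ q * F x.
  rewrite mulr_sumr; apply: eq_bigr => v _.
  by rewrite dotZr exprMn -exprM mul2n.
have Fiso x y : dot x x = dot y y -> F x = F y.
  move=> xy; have [->//|nxy] := eqVneq x y.
  by rewrite -(reflection_swap xy nxy) /F min_energy_invariant // subr_eq0.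
have [e e1] : exists e : vec, dot e e = 1.
  exists (delta_mx 0 (Ordinal d0)).
  rewrite /dot (bigD1 (Ordinal d0)) //= big1; last first.
    by move=> i /negPf i0; rewrite !mxE i0 mulr0.
  by rewrite !mxE !eqxx mulr1 addr0.
have FE x : F x = dot x x ^+ q * F e.
  rewrite -[dot x x]sqr_sqrtr ?dot_ge0 // -FZ; apply: Fiso.
  by rewrite dotZl dotZr e1 mulr1 -expr2 sqr_sqrtr ?dot_ge0.
have Fe0 : 0 < F e.
  rewrite lt_neqAle eq_sym; apply/andP; split; last first.
    by apply: sumr_ge0 => v _; rewrite -mul2n exprM exprn_ge0 ?sqr_ge0.
  apply/eqP => Fe.
  suff : power_sum s None = 0 by rewrite s1 => /eqP; rewrite oner_eq0.
  rewrite power_sum_None big1_seq // => u /andP[_ us].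
  have : F u = 0 by rewrite FE Fe mulr0.
  move/eqP; rewrite psumr_eq0 => [/allP/(_ u us) /=|v _].
    by rewrite -mul2n mulnC exprM expf_eq0 /= => /eqP.
  by rewrite -mul2n exprM exprn_ge0 ?sqr_ge0.
have [//||b b0 bE] := @exists_root R q.*2 (F e)^-1; first by rewrite double_gt0.
  by rewrite invr_ge0 ltW.
exists [seq b *: v | v <- s] => x; rewrite big_map.
under eq_bigr do rewrite dotZl exprMn.
by rewrite -mulr_sumr -/(F x) FE bE mulrCA mulVf ?mulr1 ?lt0r_neq0.
Qed.

End Hilbert.

(** * Real components of the scalars *)

Section Scalars.
Variables (R : realType) (k : scalar_kind).
Local Notation K := (scalar_ring R k).
Local Notation delta := (real_dim k).
Implicit Types (a b z : K) (r : R).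

Definition component a (l : nat) : R := (scalar_coords a)`_l.

Definition re_part a : R := component a 0.

Definition of_components (f : nat -> R) : K :=
  match k return scalar_ring R k with
  | Reals => f 0%N
  | Complexes => Complex (f 0%N) (f 1%N)
  | Quaternions => Quat (f 0%N) (f 1%N) (f 2%N) (f 3%N)
  end.

Definition unit_vec (l : nat) : K := of_components (fun i => (i == l)%:R).

Definition real_scalar r : K :=
  of_components (fun i => if i is 0%N then r else 0).

Definition sqnorm a : R := \sum_(l < delta) component a l ^+ 2.

End Scalars.

Section ScalarTheory.
Variable R : realType.

Lemma ReM (a b : R[i]) : complex.Re (a * b) =
  complex.Re a * complex.Re b - complex.Im a * complex.Im b.
Proof. by case: a b => ? ? [? ?]. Qed.

Lemma ImM (a b : R[i]) : complex.Im (a * b) =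
  complex.Re a * complex.Im b + complex.Im a * complex.Re b.
Proof. by case: a b => ? ? [? ?]. Qed.

Lemma ReD (a b : R[i]) : complex.Re (a + b) = complex.Re a + complex.Re b.
Proof. by case: a b => ? ? [? ?]. Qed.

Lemma ImD (a b : R[i]) : complex.Im (a + b) = complex.Im a + complex.Im b.
Proof. by case: a b => ? ? [? ?]. Qed.

Variable k : scalar_kind.
Local Notation K := (scalar_ring R k).
Local Notation delta := (real_dim k).
Implicit Types (a b z : K) (r : R).

Ltac by_components :=
  rewrite /sqnorm /re_part /component /unit_vec /real_scalar
    ?big_ord_recl ?big_ord0 /= ?(ReM, ImM, ReD, ImD) /=.

Lemma sqnormM a b : sqnorm (a * b) = sqnorm a * sqnorm b.
Proof. by move: a b; case: k => /= a b; by_components; ring. Qed.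

Lemma re_partC a b : re_part (a * b) = re_part (b * a).
Proof. by move: a b; case: k => /= a b; by_components; ring. Qed.

Lemma componentD a b l : component (a + b) l = component a l + component b l.
Proof.
move: a b l; case: k => /= a b [|[|[|[|l]]]]; by_components;
  rewrite ?nth_nil ?addr0 //.
Qed.

(** The real part of a product with a is a real linear function of the
    components; its coefficients are its values at the standard units. *)
Lemma re_partM a b :
  re_part (a * b) =
  \sum_(l < delta) re_part (a * unit_vec R k l) * component b l.
Proof. by move: a b; case: k => /= a b; by_components; ring. Qed.

(** Up to sign, the components of a are the real parts of its products with the
    standard units. *)
Lemma sqnormE a :
  sqnorm a = \sum_(l < delta) re_part (unit_vec R k l * a) ^+ 2.
Proof. by move: a; case: k => /= a; by_components; ring. Qed.

(** The scalar a is the conjugate of the one with components f. *)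
Lemma re_part_dual (f : nat -> R) :
  exists a, forall z, re_part (a * z) = \sum_(l < delta) f l * component z l.
Proof.
case: k => /=; [exists (f 0%N)|exists (Complex (f 0%N) (- f 1%N))|
  exists (Quat (f 0%N) (- f 1%N) (- f 2%N) (- f 3%N))] => z; by_components; ring.
Qed.

Lemma real_scalarC r a : real_scalar k r * a = a * real_scalar k r.
Proof.
move: a; case: k => /= a; first exact: mulrC; first exact: mulrC.
by case: a => ? ? ? ?; congr Quat => /=; ring.
Qed.

Lemma sqnorm_real r : sqnorm (real_scalar k r) = r ^+ 2.
Proof. by case: k => /=; by_components; ring. Qed.

Lemma real_scalarN r : real_scalar k (- r) = - real_scalar k r.
Proof.
case: k => //=; rewrite /real_scalar /=.
  by apply/eqP; rewrite eq_complex /= oppr0 !eqxx.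
by rewrite -[RHS]/(quat_opp _) /quat_opp /= oppr0.
Qed.

Lemma real_scalar0 : real_scalar k 0 = 0 :> K.
Proof. by case: k. Qed.

Lemma real_scalar1 : real_scalar k 1 = 1 :> K.
Proof. by case: k. Qed.

Lemma re_partZ r a : re_part (real_scalar k r * a) = r * re_part a.
Proof. by move: a; case: k => /= a; by_components; ring. Qed.

Lemma exists_conj a : exists b, a * b = real_scalar k (sqnorm a).
Proof.
move: a; case: k => /= a; [exists a|exists (Complex (complex.Re a) (- complex.Im a))|
  exists (Quat (qre a) (- qi a) (- qj a) (- qk a))].
- by by_components; ring.
- by case: a => a1 a2; rewrite /real_scalar /=; congr Complex; by_components; ring.
- by case: a => ? ? ? ?; congr Quat; by_components; ring.
Qed.

Lemma sqnorm_ge0 a : 0 <= sqnorm a.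
Proof. by apply: sumr_ge0 => l _; exact: sqr_ge0. Qed.

Lemma sqnorm_eq0 a : (sqnorm a == 0) = (a == 0).
Proof.
rewrite psumr_eq0 => [|l _]; last exact: sqr_ge0.
apply/allP/eqP => [H|-> l _]; last first.
  by case: k l => /= l; rewrite /component /= sqrf_eq0;
    case: l => [[|[|[|[|]]]]] //=; rewrite eqxx.
have {}H l : (l < delta)%N -> component a l = 0.
  move=> ld; have := H (Ordinal ld); rewrite mem_index_enum => /(_ isT).
  by rewrite /= sqrf_eq0 => /eqP.
move: a H; case: k => /= a H; rewrite /component /= in H.
- exact: (H 0%N).
- by case: a H => ? ? H; move: (H 0%N isT) (H 1%N isT) => /= -> ->.
- case: a H => ? ? ? ? H.
  move: (H 0%N isT) (H 1%N isT) (H 2%N isT) (H 3%N isT) => /= -> -> -> -> //.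
Qed.

Lemma sqnorm1 : sqnorm (1 : K) = 1.
Proof. by rewrite -real_scalar1 sqnorm_real expr1n. Qed.

Lemma scalar_absE a : scalar_abs a = Num.sqrt (sqnorm a).
Proof.
move: a; case: k => /= a; by_components; rewrite ?addr0 ?sqrtr_sqr ?addrA //.
by case: a.
Qed.

End ScalarTheory.

(** * Right-linear functionals *)

Section Pairing.
Variables (R : realType) (k : scalar_kind) (m : nat).
Local Notation K := (scalar_ring R k).
Local Notation delta := (real_dim k).
Implicit Types (u x : 'cV[K]_m) (a : K) (r : R).

Definition pairing u x : K := \sum_j u j 0 * x j 0.

Definition lscale a u : 'cV[K]_m := \col_j (a * u j 0).

Definition sqnorm_vec x : R := \sum_j sqnorm (x j 0).

Lemma pairing_rscale u x a : pairing u (rscale x a) = pairing u x * a.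
Proof. by rewrite mulr_suml; apply: eq_bigr => j _; rewrite mxE mulrA. Qed.

Lemma pairing_lscale u x a : pairing (lscale a u) x = a * pairing u x.
Proof. by rewrite mulr_sumr; apply: eq_bigr => j _; rewrite mxE mulrA. Qed.

Lemma sqnorm_vec_rscale x a : sqnorm_vec (rscale x a) = sqnorm_vec x * sqnorm a.
Proof. by rewrite mulr_suml; apply: eq_bigr => j _; rewrite mxE sqnormM. Qed.

Lemma pairing_delta u j : pairing u (delta_mx j 0) = u j 0.
Proof.
rewrite /pairing (bigD1 j) //= big1 ?addr0; last first.
  by move=> i /negPf ij; rewrite mxE ij mulr0.
by rewrite mxE !eqxx mulr1.
Qed.

Lemma re_part_pairing u x : re_part (pairing u x) =
  \sum_j \sum_(l < delta) re_part (u j 0 * unit_vec R k l) * component (x j 0) l.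
Proof.
have re0 : re_part (0 : K) = 0.
  by rewrite -(mul0r 0) -(real_scalar0 R k) re_partZ mul0r.
rewrite /pairing (big_morph (@re_part R k) (fun a b => componentD a b 0) re0).
by apply: eq_bigr => j _; exact: re_partM.
Qed.

Lemma re_part_pairing_dual (f : 'I_m -> nat -> R) : exists u, forall x,
  re_part (pairing u x) = \sum_j \sum_(l < delta) f j l * component (x j 0) l.
Proof.
have /choice[a aE] j := re_part_dual k (f j).
exists (\col_j a j) => x; rewrite re_part_pairing; apply: eq_bigr => j _.
by rewrite mxE -re_partM aE.
Qed.

(** With c the conjugate of u_1, the vector with first coordinates - |u_1|^2 and
    c u_0 is orthogonal to u. *)
Lemma exists_orthogonal u : (1 < m)%N -> exists2 x, x != 0 & pairing u x = 0.
Proof.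
move=> m1; pose j0 : 'I_m := Ordinal (ltnW m1); pose j1 : 'I_m := Ordinal m1.
have [u1|u1] := eqVneq (u j1 0) 0.
  exists (delta_mx j1 0); last by rewrite pairing_delta.
  by apply/eqP => /matrixP/(_ j1 0)/eqP; rewrite !mxE !eqxx oner_eq0.
have [c uc] := exists_conj (u j1 0).
pose r := sqnorm (u j1 0).
exists (rscale (delta_mx j0 0) (real_scalar k (- r)) +
        rscale (delta_mx j1 0) (c * u j0 0)).
  apply/eqP => /matrixP/(_ j0 0)/eqP; rewrite !mxE !eqxx mul1r mul0r addr0.
  rewrite -sqnorm_eq0 sqnorm_real sqrf_eq0 oppr_eq0 sqnorm_eq0.
  by rewrite (negPf u1).
rewrite -[pairing u _]/(\sum_j _).
under eq_bigr do rewrite mxE mulrDr.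
rewrite big_split -![\sum_j _]/(pairing u _) !pairing_rscale !pairing_delta.
rewrite mulrA uc real_scalarN mulrN real_scalarC; exact: addNr.
Qed.

Lemma sqnorm_vec_gt0 x : x != 0 -> 0 < sqnorm_vec x.
Proof.
move=> /negP x0; rewrite lt_neqAle sumr_ge0 ?andbT => [|j _]; last first.
  exact: sqnorm_ge0.
rewrite eq_sym; apply/negP; rewrite psumr_eq0 => [|j _]; last exact: sqnorm_ge0.
move=> /allP H; apply: x0; apply/eqP/matrixP => j i; rewrite ord1 mxE.
by apply/eqP; rewrite -sqnorm_eq0; apply: H; rewrite mem_index_enum.
Qed.

End Pairing.

Lemma sum_mxvec_index (V : nmodType) (m n : nat) (F : 'I_(m * n) -> V) :
  \sum_i F i = \sum_j \sum_l F (mxvec_index j l).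
Proof.
rewrite (reindex _ (curry_mxvec_bij _ _)) /= pair_bigA.
by apply: eq_bigr => -[].
Qed.

(** * The norm as a sum of powers over the scalars *)

Section HilbertK.
Variables (R : realType) (k : scalar_kind) (q : nat).
Hypothesis q_gt0 : (0 < q)%N.
Local Notation K := (scalar_ring R k).
Local Notation delta := (real_dim k).

(** The real identity, on K^m as a real space of dimension m * delta. *)
Lemma real_hilbert_vec (m : nat) : exists us : seq 'cV[K]_m, forall x,
  \sum_(u <- us) re_part (pairing u x) ^+ q.*2 = sqnorm_vec x ^+ q.
Proof.
have [s sE] := hilbert_identity R (m * delta)%N q_gt0.
have /choice[g gE] (v : 'rV[R]_(m * delta)) : exists u : 'cV[K]_m, forall x,
    re_part (pairing u x) =
    dot v (mxvec (\matrix_(j, l) component (x j 0) (l : 'I_delta))).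
  have [u uE] := re_part_pairing_dual k
    (fun (j : 'I_m) l =>
      if insub l is Some l' then vec_mx v j (l' : 'I_delta) else 0).
  exists u => x; rewrite uE /dot sum_mxvec_index.
  apply: eq_bigr => j _; apply: eq_bigr => l _.
  by rewrite valK mxvecE !mxE.
exists (map g s) => x; rewrite big_map.
under eq_bigr do rewrite gE.
rewrite sE /dot sum_mxvec_index; congr (_ ^+ _).
apply: eq_bigr => j _; apply: eq_bigr => l _.
by rewrite mxvecE mxE expr2.
Qed.

Lemma real_hilbert_scalar : exists al : seq K, forall z,
  \sum_(a <- al) re_part (a * z) ^+ q.*2 = sqnorm z ^+ q.
Proof.
have [us usE] := real_hilbert_vec 1.
exists [seq u 0 0 | u : 'cV[K]_1 <- us] => z; rewrite big_map.
have := usE (const_mx z); rewrite /sqnorm_vec big_ord1 mxE => <-.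
by apply: eq_bigr => u _; rewrite /pairing big_ord1 mxE.
Qed.

(** Replace x by x a in the real identity
    sum_u re_part (pairing u x) ^+ 2q = |x| ^+ 2q, and sum over scalars a with
    sum_a re_part (a z) ^+ 2q = |z| ^+ 2q.  The left-hand side becomes
    sum_u |pairing u x| ^+ 2q, because re_part (z a) = re_part (a z), and the
    right-hand side becomes a positive multiple of |x| ^+ 2q. *)
Lemma hilbert_identity_scalars (m : nat) : exists us : seq 'cV[K]_m, forall x,
  \sum_(u <- us) sqnorm (pairing u x) ^+ q = sqnorm_vec x ^+ q.
Proof.
have [us usE] := real_hilbert_vec m.
have [al alE] := real_hilbert_scalar.
pose c := \sum_(a <- al) sqnorm a ^+ q.
have cE x : \sum_(u <- us) sqnorm (pairing u x) ^+ q = c * sqnorm_vec x ^+ q.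
  under eq_bigr do rewrite -alE.
  rewrite exchange_big mulr_suml; apply: eq_bigr => a _ /=.
  rewrite mulrC -exprMn -sqnorm_vec_rscale -usE; apply: eq_bigr => u _.
  by rewrite pairing_rscale re_partC.
have c0 : 0 < c.
  rewrite lt_neqAle sumr_ge0 ?andbT => [|a _]; last by rewrite exprn_ge0 ?sqnorm_ge0.
  rewrite eq_sym; apply/negP; rewrite psumr_eq0 => [|a _]; last first.
    by rewrite exprn_ge0 ?sqnorm_ge0.
  move=> /allP H; have := alE 1; rewrite sqnorm1 expr1n big1_seq => [/eqP|].
    by rewrite eq_sym oner_eq0.
  move=> a /andP[_ /H]; rewrite /= expf_eq0 q_gt0 sqnorm_eq0 => /eqP ->.
  by rewrite -(real_scalar0 R k) re_partZ mul0r expr0n double_eq0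
    (negPf (lt0n_neq0 q_gt0)).
have [//||b b0 bE] := @exists_root R q.*2 c^-1; first by rewrite double_gt0.
  by rewrite invr_ge0 ltW.
exists [seq lscale (real_scalar k b) u | u <- us] => x; rewrite big_map.
under eq_bigr do rewrite pairing_lscale sqnormM sqnorm_real exprMn -exprM mul2n bE.
by rewrite -mulr_sumr cE mulKf ?lt0r_neq0.
Qed.

Lemma embeddable_of_identity (m : nat) (us : seq 'cV[K]_m) :
  (forall x, \sum_(u <- us) sqnorm (pairing u x) ^+ q = sqnorm_vec x ^+ q) ->
  embeddable k (q.*2%:R : R) m (size us).
Proof.
move=> usE; exists (fun x => \col_i pairing (us`_i) x); split; first split.
- move=> x y; apply/matrixP => i j; rewrite !mxE -big_split.
  by apply: eq_bigr => l _; rewrite mxE mulrDr.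
- by move=> x a; apply/matrixP => i j; rewrite !mxE pairing_rscale.
- move=> x; rewrite /lp_norm.
  have absE p (a : K) : scalar_abs a `^ p%:R = Num.sqrt (sqnorm a) ^+ p.
    by rewrite scalar_absE powR_mulrn ?sqrtr_ge0.
  have -> : \sum_(i < size us) scalar_abs ((\col_i pairing us`_i x) i 0) `^ q.*2%:R =
      sqnorm_vec x ^+ q.
    rewrite -usE [RHS](big_nth 0) big_mkord; apply: eq_bigr => i _.
    by rewrite absE mxE -mul2n exprM sqr_sqrtr ?sqnorm_ge0.
  have -> : \sum_(i < m) scalar_abs (x i 0) `^ 2 = sqnorm_vec x.
    by apply: eq_bigr => i _; rewrite absE sqr_sqrtr ?sqnorm_ge0.
  have n0 : 0 <= sqnorm_vec x by apply: sumr_ge0 => j _; exact: sqnorm_ge0.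
  rewrite -(powR_mulrn q n0) -powRrM; congr (_ `^ _).
  rewrite -mul2n natrM invfM mulrCA divff ?mulr1 //.
  by rewrite pnatr_eq0 -lt0n.
Qed.

End HilbertK.

(** * Curves of polynomials *)

Section Curves.
Variables (R : realType) (n : nat).
Local Notation mp := (mpoly n R).

Definition continuous_coeffs (f : R -> mp) : Prop :=
  forall m, continuous (fun t => mcoeff m (f t)).

Lemma continuous_coeffsM f g : continuous_coeffs f -> continuous_coeffs g ->
  continuous_coeffs (fun t => f t * g t).
Proof.
move=> fc gc m; under eq_fun do rewrite mcoeffM -big_filter.
by apply: continuous_bigsum => c; apply: continuous_mulr; [exact: fc|exact: gc].
Qed.

Lemma continuous_coeffsX f d : continuous_coeffs f ->
  continuous_coeffs (fun t => f t ^+ d).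
Proof.
move=> fc; elim: d => [|d IH].
  by under eq_fun do rewrite expr0; move=> m t; exact: cvg_cst.
by under eq_fun do rewrite exprS; exact: continuous_coeffsM.
Qed.

Lemma continuous_coeffs_sum (I : Type) (r : seq I) (F : I -> R -> mp) :
  (forall i, continuous_coeffs (F i)) ->
  continuous_coeffs (fun t => \sum_(i <- r) F i t).
Proof.
move=> Fc m; under eq_fun do rewrite raddf_sum /=.
by apply: continuous_bigsum => i; exact: Fc.
Qed.

End Curves.

(** A linear function on forms of degree d is a linear combination of the
    coefficients of the finitely many monomials of degree d. *)
Lemma continuous_functional (R : realType) (n d : nat)
    (h : R -> dhomog n.+1 R d) (c : {scalar dhomog n.+1 R d}) :
  continuous_coeffs (fun t => mpoly_of_dhomog (h t)) ->
  continuous (fun t => c (h t)).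
Proof.
move=> hc.
(* The index type has all monomials of degree at most d; indhomog sends those of
   lower degree to 0, and their coefficients in h t vanish. *)
pose mon (m : bmultinom n.+1 d.+1) : dhomog n.+1 R d := indhomog d (mpolyX R m).
have hE t : h t = \sum_(m : bmultinom n.+1 d.+1) mcoeff m (h t) *: mon m.
  have homog_h := dhomog_is_dhomog (h t).
  apply: val_inj; rewrite /= [LHS](@mpolywE _ _ d.+1); last first.
    rewrite msizeE; apply/bigmax_leqP_seq => m mh _.
    by rewrite ltnS (dhomog_mf homog_h mh).
  rewrite raddf_sum; apply: eq_bigr => m _.
  rewrite [RHS]linearZ /= /mon /indhomog val_insubd dhomogX /=.
  case: eqP => // /eqP md.
  by rewrite (dhomog_nemf_coeff homog_h md) !scale0r.
under eq_fun do rewrite hE linear_sum.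
apply: continuous_bigsum => m; under eq_fun do rewrite linearZ.
by apply: continuous_mulr => [|t]; [exact: hc|exact: cvg_cst].
Qed.

Lemma nth_flatten_const (T I : Type) (x0 : T) (i0 : I) (F : I -> seq T)
    (s : seq I) (d j l : nat) : (forall i, size (F i) = d) ->
  (j < size s)%N -> (l < d)%N ->
  nth x0 (flatten [seq F i | i <- s]) (j * d + l) = nth x0 (F (nth i0 s j)) l.
Proof.
move=> Fd; elim: s j => [|i s IH] [|j] //= js ld; rewrite nth_cat Fd.
  by rewrite mul0n add0n ld.
rewrite mulSn -addnA ltnNge leq_addr /= addnC addnK.
exact: IH.
Qed.

(** * The forms generated by functionals *)

Lemma size_scalar_coords (R : realType) (k : scalar_kind) (a : scalar_ring R k) :
  size (scalar_coords a) = real_dim k.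
Proof. by move: a; case: k. Qed.

Section Forms.
Variables (R : realType) (k : scalar_kind) (m q : nat).
Hypothesis q_gt0 : (0 < q)%N.
Local Notation K := (scalar_ring R k).
Local Notation delta := (real_dim k).
Local Notation n := (nvars k m).
Local Notation V := (real_form R k m q.*2).
Implicit Types (u x : 'cV[K]_m).

Lemma real_coordsE x (j : 'I_m) (l : 'I_delta) :
  (real_coords x)`_(j * delta + l) = component (x j 0) l.
Proof.
rewrite /real_coords (nth_flatten_const 0 j) ?size_enum_ord ?nth_ord_enum // => i.
exact: size_scalar_coords.
Qed.

Definition var_index (j : 'I_m) (l : 'I_delta) : 'I_n := inord (j * delta + l).

Lemma var_indexE (j : 'I_m) (l : 'I_delta) :
  var_index j l = (j * delta + l)%N :> nat.
Proof.
rewrite inordK // (leq_trans _ (leqSpred _)) //.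
rewrite (@leq_trans (j.+1 * delta)) ?leq_mul2r ?ltn_ord ?orbT //.
by rewrite mulSn addnC ltn_add2r.
Qed.

(** The polynomial in the real coordinates of x given by the real part of
    unit_vec l * pairing u x. *)
Definition linear_poly (l : nat) u : mpoly n R :=
  \sum_j \sum_(l' < delta) re_part (unit_vec R k l * u j 0 * unit_vec R k l') *:
    mpolyX R (mnm1 (var_index j l')).

Lemma meval_linear_poly l u x :
  meval (fun i : 'I_n => (real_coords x)`_i) (linear_poly l u) =
  re_part (unit_vec R k l * pairing u x).
Proof.
rewrite -pairing_lscale re_part_pairing raddf_sum; apply: eq_bigr => j _.
rewrite raddf_sum; apply: eq_bigr => l' _ /=.
by rewrite mevalZ mevalXU var_indexE real_coordsE mxE.
Qed.

Definition power_poly u : mpoly n R :=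
  (\sum_(l < delta) linear_poly l u ^+ 2) ^+ q.

Lemma power_poly_homog u : power_poly u \is ishomog1 q.*2 (mdeg (n:=n)).
Proof.
rewrite -mul2n; apply: dhomogMn; apply: rpred_sum => l _.
rewrite -[2%N]mul1n; apply: dhomogMn; apply: rpred_sum => j _.
by apply: rpred_sum => l' _; apply: rpredZ; rewrite dhomogX; apply/eqP; exact: mdeg1.
Qed.

Definition power_form u : V := DHomog (power_poly_homog u).

Lemma power_formE u x : form_eval (power_form u) x = sqnorm (pairing u x) ^+ q.
Proof.
rewrite /form_eval /= rmorphXn rmorph_sum sqnormE; congr (_ ^+ _).
by apply: eq_bigr => l _; rewrite rmorphXn /= meval_linear_poly.
Qed.

Lemma power_form_in_Phi u : power_form u \in Phi R k m q.*2.
Proof.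
apply/memPhi => x a a1; rewrite !power_formE pairing_rscale sqnormM.
suff -> : sqnorm a = 1 by rewrite mulr1.
by rewrite -(sqr_sqrtr (sqnorm_ge0 a)) -scalar_absE a1 expr1n.
Qed.

Lemma linear_polyD l u v :
  linear_poly l (u + v) = linear_poly l u + linear_poly l v.
Proof.
rewrite -big_split; apply: eq_bigr => j _; rewrite -big_split.
apply: eq_bigr => l' _ /=.
by rewrite -scalerDl mxE mulrDr mulrDl [re_part (_ + _)]componentD.
Qed.

Lemma linear_polyZ l (r : R) u :
  linear_poly l (lscale (real_scalar k r) u) = r *: linear_poly l u.
Proof.
rewrite scaler_sumr; apply: eq_bigr => j _; rewrite scaler_sumr.
apply: eq_bigr => l' _; rewrite scalerA; congr (_ *: _).
by rewrite mxE -re_partZ !mulrA real_scalarC.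
Qed.

Lemma power_formZ (r : R) u :
  power_form (lscale (real_scalar k r) u) = r ^+ q.*2 *: power_form u.
Proof.
apply: val_inj; rewrite /= /power_poly -mul2n exprM -exprZn scaler_sumr.
by under eq_bigr do rewrite linear_polyZ exprZn.
Qed.

Lemma power_form_eq0 u : (power_form u == 0) = (u == 0).
Proof.
apply/eqP/eqP => [u0|->]; last first.
  have -> : 0 = lscale (real_scalar k 0) (0 : 'cV[K]_m).
    by apply/matrixP => i j; rewrite !mxE mulr0.
  by rewrite power_formZ expr0n double_eq0 (negPf (lt0n_neq0 q_gt0)) scale0r.
apply/matrixP => j i; rewrite ord1 mxE; apply/eqP.
rewrite -sqnorm_eq0 -(pairing_delta u j) -[_ == 0]andTb -q_gt0 -expf_eq0.
by rewrite -power_formE u0 /form_eval raddf0.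
Qed.

Let S (v : V) := exists u, v = power_form u.

(** Move the functional along the segment from u to v.  The segment can pass
    through 0 only if u and v are linearly dependent over the reals, and then
    their forms are proportional. *)
Lemma power_form_path u v : free [:: power_form u; power_form v] ->
  exists h : R -> V, [/\ h 0 = power_form u, h 1 = power_form v,
    forall t, S (h t) /\ h t != 0 &
    forall N (X : N.-tuple V) i, continuous (fun t => coord X i (h t))].
Proof.
move=> fuv.
pose w t := lscale (real_scalar k (1 - t)) u + lscale (real_scalar k t) v.
have l0 (x : 'cV[K]_m) : lscale (real_scalar k 0) x = 0.
  by apply/matrixP => i j; rewrite ord1 !mxE real_scalar0 mul0r.
have l1 (x : 'cV[K]_m) : lscale (real_scalar k 1) x = x.
  by apply/matrixP => i j; rewrite ord1 !mxE real_scalar1 mul1r.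
exists (fun t => power_form (w t)); split.
- by rewrite /w subr0 l0 l1 addr0.
- by rewrite /w subrr l0 l1 add0r.
- move=> t; split; first by exists (w t).
  rewrite power_form_eq0; apply/eqP => /eqP; rewrite addr_eq0 => /eqP wt.
  have {}wt : lscale (real_scalar k (1 - t)) u = lscale (real_scalar k (- t)) v.
    by rewrite wt; apply/matrixP => i j; rewrite !mxE real_scalarN mulNr.
  have := congr1 power_form wt; rewrite !power_formZ => /eqP.
  rewrite -subr_eq0 -scaleNr => /eqP rel.
  pose c (i : 'I_2) := if i == ord0 then (1 - t) ^+ q.*2 else - (- t) ^+ q.*2.
  have c0 : forall i, c i = 0.
    have /freeP fP : free [tuple power_form u; power_form v] := fuv.
    apply: fP.
    by rewrite !big_ord_recl big_ord0 addr0.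
  have /eqP := c0 ord0; rewrite expf_eq0 subr_eq0 => /andP[_ /eqP t1].
  have /eqP := c0 ord_max; rewrite /c /= oppr_eq0 expf_eq0 oppr_eq0 -t1 oner_eq0.
  by rewrite andbF.
- move=> N X i; apply: continuous_functional.
  apply: continuous_coeffsX; apply: continuous_coeffs_sum => l.
  apply: continuous_coeffsX => M.
  under eq_fun do rewrite linear_polyD !linear_polyZ mcoeffD !mcoeffZ.
  move=> t; apply: cvgD; (apply: cvgM; last exact: cvg_cst); last exact: cvg_id.
  by apply: cvgB; [exact: cvg_cst|exact: cvg_id].
Qed.

Lemma power_form_seq (s : seq V) : (forall v, v \in s -> S v) ->
  exists us, s = map power_form us.
Proof.
elim: s => [|v s IH] Ss; first by exists [::].
have [u ->] := Ss v (mem_head _ _).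
have [|us ->] := IH; last by exists (u :: us).
by move=> w ws; apply: Ss; rewrite inE ws orbT.
Qed.

Lemma power_form_sumE (us : seq 'cV[K]_m) x :
  form_eval (\sum_(u <- us) power_form u) x =
  \sum_(u <- us) sqnorm (pairing u x) ^+ q.
Proof.
rewrite /form_eval !raddf_sum; apply: eq_bigr => u _; exact: power_formE.
Qed.

(** The forms take nonnegative values, and the value at the standard basis
    vector j is the power |u_j| ^+ 2q. *)
Lemma power_form_pointed (s : seq V) : (forall v, v \in s -> S v) ->
  \sum_(v <- s) v = 0 -> forall v, v \in s -> v = 0.
Proof.
move=> /power_form_seq[us ->]; rewrite big_map => s0 _ /mapP[u uus ->].
apply/eqP; rewrite power_form_eq0; apply/eqP/matrixP => j i.
rewrite ord1 mxE; apply/eqP.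
rewrite -sqnorm_eq0 -(pairing_delta u j) -[_ == 0]andTb -q_gt0 -expf_eq0.
have /eqP := power_form_sumE us (delta_mx j 0).
rewrite s0 [form_eval _ _]raddf0 eq_sym psumr_eq0 => [/allP/(_ u uus) //|w _].
by rewrite exprn_ge0 ?sqnorm_ge0.
Qed.

(** Carathéodory's theorem gives linearly independent terms, hence at most
    dim Phi of them.  When there are exactly dim Phi, the theorem of Fenchel
    and Bunt saves one, provided that there are at least two: a single
    functional vanishes at some nonzero vector, where the norm does not. *)
Lemma short_identity : (1 < m)%N -> exists us : seq 'cV[K]_m,
  (size us < \dim (Phi R k m q.*2))%N /\
  forall x, \sum_(u <- us) sqnorm (pairing u x) ^+ q = sqnorm_vec x ^+ q.
Proof.
move=> m1; have [us0 us0E] := hilbert_identity_scalars R k q_gt0 m.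
have scaleS a (v : V) : 0 <= a -> S v -> S (a *: v).
  move=> a0 [u ->]; have [|b b0 <-] := @exists_root R q.*2 a _ a0.
    by rewrite double_gt0.
  by exists (lscale (real_scalar k b) u); rewrite power_formZ.
have SPhi v : S v -> v \in Phi R k m q.*2.
  by move=> [u ->]; exact: power_form_in_Phi.
have [|s [fs Ss sE]] := cone_caratheodory scaleS (s := map power_form us0).
  by move=> _ /mapP[u _ ->]; exists u.
suff [s' [s'd Ss' s'E]] : exists s' : seq V,
    [/\ (size s' < \dim (Phi R k m q.*2))%N, forall v, v \in s' -> S v &
      \sum_(v <- s') v = \sum_(v <- s) v].
  have [us e] := power_form_seq Ss'; exists us; split.
    by rewrite e size_map in s'd.
  move=> x; rewrite -us0E -!power_form_sumE.
  by rewrite -!(big_map power_form xpredT id) -e s'E sE.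
have s_le : (size s <= \dim (Phi R k m q.*2))%N.
  by rewrite -(eqnP fs) dimvS //; apply/span_subvP => v /Ss /SPhi.
have s2 : (1 < size s)%N.
  have [us e] := power_form_seq Ss.
  have usE x : \sum_(u <- us) sqnorm (pairing u x) ^+ q = sqnorm_vec x ^+ q.
    by rewrite -us0E -!power_form_sumE -!(big_map power_form xpredT id) -e sE.
  (* If us is empty, any u will do. *)
  have [u u_us] : exists u, forall w, (size s <= 1)%N -> w \in us -> w = u.
    case: us e {usE} => [|u us] e; first by exists 0.
    by exists u => w; rewrite e; case: us {e} => //= _; rewrite inE => /eqP.
  rewrite ltnNge; apply/negP => s1.
  have [x x0 ux] := exists_orthogonal u m1.
  have := usE x; rewrite big1_seq => [/esym/eqP|w /= /(u_us w s1) ->].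
    by rewrite expf_eq0 q_gt0 gt_eqF // sqnorm_vec_gt0.
  rewrite ux (_ : sqnorm 0 = 0) ?expr0n ?(negPf (lt0n_neq0 q_gt0)) //.
  by apply/eqP; rewrite sqnorm_eq0.
case: (ltngtP (size s) (\dim (Phi R k m q.*2))) s_le => // [s_lt _|s_eq _].
  by exists s.
rewrite -s_eq; apply: (cone_fenchel_bunt scaleS SPhi power_form_pointed) => //.
by move=> _ _ [u ->] [v ->]; exact: power_form_path.
Qed.

End Forms.

Theorem mainTheorem1 (R : realType) (k : scalar_kind) (m p : nat)
    (hm : (2 <= m)%N) (hp0 : (0 < p)%N) (hp : ~~ odd p) :
  exists N : nat, is_min_embedding_dim k (p%:R : R) m N /\
    (N%:Z <= (\dim (Phi R k m p))%:Z - 1)%R.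
Proof.
have pE : p = p./2.*2 by rewrite even_halfK.
have q0 : (0 < p./2)%N by rewrite half_gt0; case: p hp0 hp {pE} => [|[]].
have [us [us_lt usE]] := short_identity R k q0 hm.
have emb : embeddable k (p%:R : R) m (size us).
  by rewrite pE; exact: embeddable_of_identity.
rewrite -pE in us_lt.
have exE : exists n, `[< embeddable k (p%:R : R) m n >].
  by exists (size us); apply/asboolP.
case: (ex_minnP exE) => N /asboolP embN minN; exists N; split.
  by split=> // n /asboolP; exact: minN.
rewrite lerBrDr -PoszD lez_nat addn1 (leq_ltn_trans _ us_lt) //.
by apply: minN; apply/asboolP.
Qed.
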